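(* For any graph $H$, there exists a graph $G$ such that the compatibility graph $\mathsf{B}(G)$ has an induced subgraph isomorphic to $H$.
   Context: Every graph $G=(V,E)$ is finite, connected and simple with unit edge weights (this convention applies to $G$ and $H$, not to the compatibility graph defined below); $d(u,v)$ is the graph distance. A probability measure on $V$ is identified with a function $\mu:V\to\mathbb{R}_{\ge 0}$ with $\sum_{v\in V}\mu(v)=1$. The support is $\operatorname{spt}\mu=\{v\in V:\mu(v)>0\}$. The transport cost function is $T_\mu(v)=\sum_{u\in V}d(u,v)\mu(u)$, and the cost-maximizing set is $M_\mu=\{v\in V: T_\mu(v)=\max_{u\in V}T_\mu(u)\}$. A probability measure $\mu$ is balanced if $\operatorname{spt}\mu\subseteq M_\mu$. A probability measure $\mu$ is basic if for every probability measure $\nu\ne\mu$ on $V$ at least one of $\operatorname{spt}\mu\neq\operatorname{spt}\nu$ or $M_\mu\ne M_\nu$ holds. Two probability measures $\mu,\nu$ are compatible if $\operatorname{spt}\mu\cup\operatorname{spt}\nu\subseteq M_\mu\cap M_\nu$. $\mathsf{B}(G)$ denotes the set of all basic balanced measures on $G$; it is made into a simple graph (the compatibility graph of $G$) by joining distinct $\mu,\nu\in\mathsf{B}(G)$ by an edge if and only if $\mu$ and $\nu$ are compatible. *)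

(* Defs.v *)
From mathcomp Require Import all_boot all_order all_algebra.
From mathcomp Require Import boolp classical_sets functions reals.

Set Implicit Arguments.
Unset Strict Implicit.
Unset Printing Implicit Defensive.

Import Order.TTheory GRing.Theory Num.Theory.

Local Open Scope ring_scope.

(* A connected graph is nonempty, so that the maximum of a function on the
   vertices makes sense. *)
Record sgraph := SGraph {
  vertex :> finType;
  edge : rel vertex;
  edge_sym : symmetric edge;
  edge_irrefl : irreflexive edge;
  vertex_gt0 : (0 < #|vertex|)%N;
  edge_connected : forall u v, connect edge u v }.

Section Distance.
Variable G : sgraph.
Implicit Types u v : G.

(* p lists the vertices after u, so n counts edges. *)
Definition walk (n : nat) u v : bool :=
  [exists p : n.-tuple G, path (@edge G) u p && (last u p == v)].

Lemma walk_exists u v : exists n, walk n u v.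
Proof.
have /connectP[p up vE] := edge_connected u v.
by exists (size p); apply/existsP; exists (in_tuple p); rewrite /= up vE eqxx.
Qed.

Definition dist u v : nat := ex_minn (walk_exists u v).

End Distance.

Section Measures.
Variables (R : realType) (G : sgraph).
Implicit Types (mu nu : {ffun G -> R}) (v : G).

Definition probability_measure mu : Prop :=
  (forall v, 0 <= mu v) /\ \sum_v mu v = 1.

Definition spt mu : {set G} := [set v | 0 < mu v]%SET.

Definition transport_cost mu v : R := \sum_u (dist u v)%:R * mu u.

Definition cost_max mu : {set G} :=
  [set v | [forall u, transport_cost mu u <= transport_cost mu v]]%SET.

Definition balanced mu : Prop := spt mu \subset cost_max mu.

Definition basic mu : Prop :=
  forall nu, probability_measure nu -> nu <> mu ->
    spt mu <> spt nu \/ cost_max mu <> cost_max nu.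

Definition compatible mu nu : Prop :=
  spt mu :|: spt nu \subset cost_max mu :&: cost_max nu.

(* The compatibility graph of G has vertex set basic_balanced and adjacency
   compat_edge, the latter meaningful only on basic_balanced. *)
Definition basic_balanced : set {ffun G -> R} :=
  [set mu | [/\ probability_measure mu, balanced mu & basic mu]]%classic.

Definition compat_edge mu nu : Prop := mu <> nu /\ compatible mu nu.

End Measures.

(* The simple graph with vertex set W and adjacency e (used only on W) has an
   induced subgraph, on some set of vertices S, isomorphic to H. *)
Definition has_induced_copy (U : Type) (W : set U) (e : U -> U -> Prop)
    (H : sgraph) : Prop :=
  exists2 S : set U, (S `<=` W)%classic &
    exists2 f : H -> U, set_bij [set: H]%classic S f &
      forall x y : H, edge x y <-> e (f x) (f y).

(* Main.v *)
Require Import Defs.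
From mathcomp Require Import all_boot all_order all_algebra.
From mathcomp Require Import boolp classical_sets functions reals.
From mathcomp Require Import lra.

(** In a graph of diameter at most 2, write [e] for the relation of being at
    distance 2.  The transport cost of [mu] at [v] is then
    1 + mu(e-neighbours of v) - mu(v), and any symmetric irreflexive [e] occurs:
    take the complement of [e] and add an apex adjacent to everything; a measure
    that does not charge the apex costs 1 there ([cost_Some], [cost_None]).  So one
    may look for measures in an arbitrary relation [e] instead of a metric.

    Take for [e] the prism H x K_3.  A measure carried by the triangle over [x],
    with weights w_0, w_1, w_2, costs 2 - 2 w_i at the vertex [i] of that
    triangle, 1 + w_i at the vertex [i] over a neighbour of [x], and 1 everywhere
    else ([triangle_cost]).  Being balanced forces the costs over [x] to agree,
    so the weights are 1/3 ([triangle_balanced]): the uniform measure is the only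
    balanced one on its support, hence basic if it is balanced.  Conversely, with
    the weights 1/3 these costs are 4/3, 4/3 and 1, so the uniform measure is
    balanced and its cost-maximizing set consists of the triangles over [x] and
    over the neighbours of [x] ([cost_max_uniform]).  Hence the uniform measures over [x]
    and [y] are compatible exactly when [x] and [y] are equal or adjacent in H.
    The size 3 is what makes 2 - 2 w equal to 1 + w at the uniform weight. *)

Set Implicit Arguments.
Unset Strict Implicit.
Unset Printing Implicit Defensive.

Import Order.TTheory GRing.Theory Num.Theory.

Local Open Scope ring_scope.

(** * Graphs of diameter two with prescribed distance-two pairs *)

Section CoCone.
Variables (T : finType) (e : rel T).
Hypothesis e_sym : symmetric e.

Definition co_cone_edge : rel (option T) := fun u v =>
  match u, v with
  | Some p, Some q => (p != q) && ~~ e p q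
  | None, None => false
  | _, _ => true
  end.

Lemma co_cone_sym : symmetric co_cone_edge.
Proof. by case=> [p|] [q|] //=; rewrite eq_sym e_sym. Qed.

Lemma co_cone_irrefl : irreflexive co_cone_edge.
Proof. by case=> [p|] //=; rewrite eqxx. Qed.

Lemma co_cone_gt0 : (0 < #|{: option T}|)%N.
Proof. by rewrite card_option. Qed.

Lemma co_cone_connected u v : connect co_cone_edge u v.
Proof.
have to_apex w : connect co_cone_edge w None.
  by case: w => [p|]; [exact: connect1 | exact: connect0].
apply: (connect_trans (to_apex u)).
by rewrite (sym_connect_sym co_cone_sym).
Qed.

Definition co_cone : sgraph :=
  SGraph co_cone_sym co_cone_irrefl co_cone_gt0 co_cone_connected.

End CoCone.

Lemma walk0 (G : sgraph) (u v : G) : walk 0 u v = (u == v).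
Proof.
apply/existsP/eqP => [[p]|->]; last by exists [tuple]; rewrite /= eqxx.
by rewrite (tuple0 p) /= => /eqP.
Qed.

Lemma walk1 (G : sgraph) (u v : G) : walk 1 u v = edge u v.
Proof.
apply/existsP/idP => [[p]|uv].
  by case/tupleP: p => w p; rewrite (tuple0 p) /= andbT => /andP[uw /eqP<-].
by exists [tuple v]; rewrite /= uv eqxx.
Qed.

Lemma walk2 (G : sgraph) (u w v : G) : edge u w -> edge w v -> walk 2 u v.
Proof. by move=> uw wv; apply/existsP; exists [tuple w; v]; rewrite /= uw wv eqxx. Qed.

Lemma distE (G : sgraph) (u v : G) : walk 2 u v ->
  dist u v = if u == v then 0%N else if edge u v then 1%N else 2%N.
Proof.
rewrite /dist; case: ex_minnP => n nP nmin w2.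
case: eqVneq => [uv|/negPf uv].
  by apply/eqP; rewrite -leqn0 nmin // walk0; apply/eqP.
case: ifP => uv1; first have := nmin 1%N; rewrite ?walk1 ?uv1.
  by case: n nP {nmin} => [|[|n]] //; rewrite ?walk0 ?uv // => _ /(_ isT).
have := nmin _ w2.
by case: n nP {nmin} => [|[|[|n]]] //; rewrite ?walk0 ?walk1 ?uv ?uv1.
Qed.

Section CoConeCost.
Variables (R : realType) (T : finType) (e : rel T).
Hypotheses (e_sym : symmetric e) (e_irrefl : irreflexive e).
Let G := co_cone e_sym.
Implicit Type p q : T.

(** The additive form lets the cost split into the mass of the [e]-neighbours
    minus the mass at the point itself. *)
Lemma dist_Some p q :
  (dist (Some p : G) (Some q))%:R = 1 + (e p q)%:R - (p == q)%:R :> R.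
Proof.
rewrite distE; last exact: (@walk2 G _ None).
rewrite /= (inj_eq Some_inj); case: eqVneq => [->|pq] /=.
  by rewrite e_irrefl /=; lra.
by case: (e p q) => /=; lra.
Qed.

Lemma dist_None p : dist (Some p : G) None = 1%N.
Proof.
rewrite /dist; case: ex_minnP => n nP nmin.
have := nmin 1%N; rewrite walk1 => /(_ isT).
by case: n nP {nmin} => [|[|n]] //; rewrite walk0.
Qed.

Variable mu : {ffun G -> R}.
Hypotheses (mu_prob : probability_measure mu) (mu_apex : mu None = 0).

Lemma sum_option (F : G -> R) : \sum_u F u = F None + \sum_p F (Some p).
Proof.
rewrite (bigD1 None) //=; congr (_ + _).
rewrite (reindex_omap Some id) /=; last by case.
by apply: eq_bigl => p; rewrite eqxx.
Qed.

Lemma cost_None : transport_cost mu None = 1.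
Proof.
case: mu_prob => _; rewrite /transport_cost !sum_option mu_apex mulr0 !add0r.
by under [in X in _ -> X]eq_bigr do rewrite dist_None mul1r.
Qed.

Lemma cost_Some q :
  transport_cost mu (Some q) =
    1 + \sum_p (e p q)%:R * mu (Some p) - mu (Some q).
Proof.
case: mu_prob => _; rewrite /transport_cost !sum_option mu_apex mulr0 !add0r => s1.
under eq_bigr do rewrite dist_Some mulrBl mulrDl mul1r.
rewrite sumrB big_split /= s1; congr (_ - _).
rewrite (bigD1 q) //= eqxx mul1r big1 ?addr0 // => p /negPf ->.
by rewrite mul0r.
Qed.

End CoConeCost.

(** * Measures on the triangles of the prism *)

Section Prism.
Variables (R : realType) (H : sgraph).

Definition prism : rel (H * 'I_3) := fun p q =>
  if p.1 == q.1 then p.2 != q.2 else edge p.1 q.1 && (p.2 == q.2).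

Lemma prism_sym : symmetric prism.
Proof.
by move=> [x i] [y j]; rewrite /prism /= (eq_sym y) (eq_sym j) (@edge_sym H).
Qed.

Lemma prism_irrefl : irreflexive prism.
Proof. by move=> [x i]; rewrite /prism /= !eqxx. Qed.

Definition prism_graph : sgraph := co_cone prism_sym.
Local Notation G := prism_graph.
Implicit Types (x y : H) (mu nu : {ffun G -> R}).

Definition triangle x : {set G} :=
  [set u : G | if u is Some p then p.1 == x else false]%SET.

Lemma triangle_Some x y (i : 'I_3) : (Some (y, i) \in triangle x) = (y == x).
Proof. by rewrite inE. Qed.

Lemma sum_triangle x (F : H * 'I_3 -> R) :
  (forall p, p.1 != x -> F p = 0) -> \sum_p F p = \sum_i F (x, i).
Proof.
move=> F0; transitivity (\sum_y \sum_i F (y, i)).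
  by rewrite pair_big; apply: eq_bigr => -[].
rewrite (bigD1 x) //= [X in _ + X]big1 ?addr0 // => y yx.
by apply: big1 => i _; apply: F0.
Qed.

Section TriangleMeasure.
Variables (mu : {ffun G -> R}) (x : H).
Hypotheses (mu_prob : probability_measure mu).
Hypotheses (mu_triangle : forall u, u \notin triangle x -> mu u = 0).

Let mu_off p : p.1 != x -> mu (Some p) = 0.
Proof. by case: p => y i yx; rewrite mu_triangle // triangle_Some. Qed.

Let mu_apex : mu None = 0.
Proof. by rewrite mu_triangle // inE. Qed.

Lemma triangle_mass : \sum_i mu (Some (x, i)) = 1.
Proof.
case: mu_prob => _; rewrite sum_option mu_apex add0r => <-.
by rewrite -(sum_triangle (F := fun p => mu (Some p))).
Qed.

(** In the prism, [(y, i)] sees the two other vertices of the triangle over [x]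
    if [y] is [x], only [(x, i)] if [y] is a neighbour of [x], and none of them
    otherwise. *)
Lemma triangle_cost y i : transport_cost mu (Some (y, i)) =
  if x == y then 2 - 2 * mu (Some (x, i))
  else 1 + (edge x y)%:R * mu (Some (x, i)).
Proof.
rewrite (cost_Some prism_irrefl) // (sum_triangle (x := x)) => [|p px]; last first.
  by rewrite mu_off ?mulr0.
rewrite /prism /=; case: eqVneq => [<-|xy].
  have := triangle_mass; rewrite (bigD1 i) //= => mass.
  rewrite (bigD1 i) //= eqxx mul0r add0r.
  under eq_bigr => j ji do rewrite ji mul1r.
  lra.
rewrite mu_off 1?eq_sym // subr0; congr (_ + _).
rewrite (bigD1 i) //= eqxx andbT big1 ?addr0 // => j /negPf ->.
by rewrite andbF mul0r.
Qed.

Lemma triangle_cost_None : transport_cost mu None = 1.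
Proof. exact: cost_None. Qed.

(** At its own triangle the cost is a strictly decreasing function of the weight,
    so equal costs over [x] mean equal weights there. *)
Lemma triangle_balanced i : triangle x \subset cost_max mu ->
  mu (Some (x, i)) = 3^-1.
Proof.
move=> /fintype.subsetP bal.
have eq_weight j : mu (Some (x, j)) = mu (Some (x, i)).
  have le_cost k l : transport_cost mu (Some (x, k))
                       <= transport_cost mu (Some (x, l)).
    have /bal : Some (x, l) \in triangle x by rewrite triangle_Some.
    by rewrite inE => /forallP/(_ (Some (x, k))).
  have := le_cost i j; have := le_cost j i.
  rewrite !triangle_cost eqxx; lra.
have := triangle_mass; under eq_bigr do rewrite eq_weight.
rewrite sumr_const card_ord -mulr_natr; lra.
Qed.

End TriangleMeasure.

Definition uniform x : {ffun G -> R} :=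
  [ffun u => if u \in triangle x then 3^-1 else 0].

Lemma uniform_off x u : u \notin triangle x -> uniform x u = 0.
Proof. by rewrite ffunE => /negPf ->. Qed.

Lemma uniform_on x i : uniform x (Some (x, i)) = 3^-1.
Proof. by rewrite ffunE triangle_Some eqxx. Qed.

Lemma uniform_prob x : probability_measure (uniform x).
Proof.
split=> [v|]; first by rewrite ffunE; case: ifP => _; lra.
rewrite sum_option uniform_off ?inE // add0r (sum_triangle (x := x)).
  under eq_bigr do rewrite uniform_on.
  by rewrite sumr_const card_ord -mulr_natr; lra.
by case=> y i /= yx; rewrite uniform_off // triangle_Some.
Qed.

Lemma spt_uniform x : spt (uniform x) = triangle x.
Proof.
apply/setP => u; rewrite [LHS]inE ffunE.
by case: ifP => _; rewrite ?ltxx //; apply/idP; lra.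
Qed.

Lemma uniform_cost x y i : transport_cost (uniform x) (Some (y, i)) =
  if (x == y) || edge x y then 4 / 3 else 1.
Proof.
rewrite (triangle_cost (uniform_prob x) (@uniform_off x)) uniform_on.
by case: eqVneq => //= _; [|case: (edge x y) => /=]; lra.
Qed.

Lemma cost_max_uniform x y i :
  (Some (y, i) \in cost_max (uniform x)) = (x == y) || edge x y.
Proof.
rewrite inE; apply/forallP/idP => [/(_ (Some (x, i)))|near].
  rewrite !uniform_cost eqxx /=; case: ifP => // _; lra.
case=> [[z j]|]; rewrite uniform_cost near.
  by rewrite uniform_cost; case: ifP => _; lra.
rewrite (triangle_cost_None (uniform_prob x) (@uniform_off x)); lra.
Qed.

Lemma triangle_sub_cost_max x y :
  (triangle y \subset cost_max (uniform x)) = (x == y) || edge x y.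
Proof.
apply/fintype.subsetP/idP => [/(_ (Some (y, ord0)))|near [[z i]|]].
- by rewrite triangle_Some cost_max_uniform => ->.
- by rewrite triangle_Some cost_max_uniform => /eqP ->.
- by rewrite inE.
Qed.

Lemma uniform_basic_balanced x : basic_balanced (uniform x).
Proof.
have bal : triangle x \subset cost_max (uniform x).
  by rewrite triangle_sub_cost_max eqxx.
split; [exact: uniform_prob | by rewrite /balanced spt_uniform | ].
move=> nu nu_prob nu_neq.
case: (eqVneq (spt (uniform x)) (spt nu)) => [eq_spt|/eqP]; last by left.
case: (eqVneq (cost_max (uniform x)) (cost_max nu)) => [eq_max|/eqP]; last by right.
have nu_off u : u \notin triangle x -> nu u = 0.
  rewrite -spt_uniform eq_spt inE -leNgt => nu_le0.
  by apply/eqP; rewrite eq_le nu_le0; case: nu_prob => ->.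
case: nu_neq; apply/ffunP => u; case: (boolP (u \in triangle x)) => [|ux]; last first.
  by rewrite nu_off // uniform_off.
case: u => [[y i]|]; last by rewrite inE.
rewrite triangle_Some => /eqP ->; rewrite uniform_on.
(* [nu] inherits balancedness through the two equalities. *)
by apply: (triangle_balanced nu_prob nu_off); rewrite -eq_max.
Qed.

Lemma uniform_inj : injective uniform.
Proof.
move=> x y /(congr1 (@spt _ _)); rewrite !spt_uniform => /setP/(_ (Some (x, ord0))).
by rewrite !triangle_Some eqxx => /esym/eqP.
Qed.

Lemma compatible_uniform x y :
  compatible (uniform x) (uniform y) <-> (x == y) || edge x y.
Proof.
rewrite /compatible !spt_uniform finset.subUset !finset.subsetI !triangle_sub_cost_max.
by rewrite !eqxx (eq_sym y) (@edge_sym H y) /= andbT andbb.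
Qed.

Lemma compat_edge_uniform x y :
  compat_edge (uniform x) (uniform y) <-> edge x y.
Proof.
rewrite /compat_edge compatible_uniform; split=> [[neq /orP[/eqP xy|//]]|xy].
  by case: neq; rewrite xy.
split; last by rewrite xy orbT.
by move/uniform_inj => eq_xy; move: xy; rewrite eq_xy edge_irrefl.
Qed.

End Prism.

Theorem proposition4p7 (R : realType) (H : sgraph) :
  exists G : sgraph,
    has_induced_copy (@basic_balanced R G) (@compat_edge R G) H.
Proof.
exists (prism_graph H), (range (@uniform R H)).
  by move=> _ [x _ <-]; apply: uniform_basic_balanced.
exists (@uniform R H); last by move=> x y; rewrite compat_edge_uniform.
split=> [x _|x y _ _|//]; [by exists x | exact: uniform_inj].
Qed.
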